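(* Let $Q\ge 1$ be an integer (the number of qubits) and let $\tau_Q$ be the translation operator on $\mathbb{C}^{2^Q}$. Let $\omega\in\mathbb{C}$ be a root of unity of order $d$, i.e. $\omega^d=1$ and $\omega^n\neq 1$ for all integers $1\le n<d$. (1) If $d\mid Q$, then $\omega$ is an eigenvalue of $\tau_Q$. (2) Define, for positive integers $k$, $\#(k)$ recursively by $\#(1)=2$ and $$\#(k):=2^k-\sum_{\substack{k'\mid k\\ k'<k}}\#(k'),$$ and set $[\#](k):=\frac{\#(k)}{k}$. Then the complex dimension of the eigenspace $\mathrm{Eig}(\omega)$ of $\tau_Q$ is $$\dim_{\mathbb{C}}\mathrm{Eig}(\omega)=\sum_{\substack{k\ge 1\\ d\mid k,\ k\mid Q}}[\#](k).$$ (3) Consequently, if $d\mid Q$, the real (manifold) dimension of the physical sector corresponding to $\omega$ is $2\dim_{\mathbb{C}}\mathrm{Eig}(\omega)-1$.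
   Context: The Hilbert space of a $Q$-qubit system is $\mathbb{C}^{2^Q}$ with its standard inner product and orthonormal basis $\{|j\rangle : j\in\{0,1,\dots,2^Q-1\}\}$. Here $|j\rangle$ denotes the tensor product state $|b_{Q-1}\cdots b_1 b_0\rangle$, where $b_{Q-1}\cdots b_1b_0\in\{0,1\}^Q$ is the binary representation of $j$ with $Q$ digits. The translation operator $\tau_Q:\mathbb{C}^{2^Q}\to\mathbb{C}^{2^Q}$ is the linear operator that permutes this basis by cyclically shifting binary digits: $\tau_Q|b_{Q-1}b_{Q-2}\cdots b_0\rangle=|b_{Q-2}\cdots b_0b_{Q-1}\rangle$. $\mathrm{Eig}(\omega):=\ker(\tau_Q-\omega\,\mathrm{id})$ is the eigenspace of $\tau_Q$ with respect to $\omega$ (the zero space if $\omega$ is not an eigenvalue). The physical sector corresponding to an eigenvalue $\omega$ is the intersection of $\mathrm{Eig}(\omega)$ with the unit sphere of $\mathbb{C}^{2^Q}$, viewed as a real manifold. The notation $a\mid b$ means that $a$ divides $b$. *)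

(* Defs.v *)
From HB Require Import structures.
From mathcomp Require Import all_boot all_order all_algebra.
From mathcomp Require Import complex.
From mathcomp Require Import all_classical all_reals topology normedtype derive.

Set Implicit Arguments.
Unset Strict Implicit.
Unset Printing Implicit Defensive.

Import Order.TTheory GRing.Theory Num.Theory.
Import numFieldNormedType.Exports.

Local Open Scope ring_scope.
Local Open Scope classical_set_scope.

(* Binary digits are stored most significant first: the tuple                 *)
(* [:: b_(Q-1); ..; b_1; b_0], so the entry at position i has weight          *)
(* 2 ^ (Q - i.+1), and the cyclic shift b_(Q-2) .. b_0 b_(Q-1) is rot 1.      *)
Definition digits (Q : nat) (j : 'I_(2 ^ Q)) : Q.-tuple bool :=
  [tuple odd (j %/ 2 ^ (Q - i.+1)) | i < Q].

Lemma digitsK (Q : nat) (j : 'I_(2 ^ Q)) :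
  (\sum_(i < Q) tnth (digits j) i * 2 ^ (Q - i.+1))%N = j.
Proof.
under eq_bigr => i _ do rewrite tnth_mktuple.
rewrite (reindex_inj rev_ord_inj) /=.
have lo (i : 'I_Q) : (Q - (Q - i.+1).+1 = i)%N.
  by rewrite subnSK // subKn // ltnW.
under eq_bigr => i _ do rewrite lo.
case: j => j /=; elim: Q {lo} j => [|Q IHQ] j hj.
  by rewrite big_ord0; case: j hj.
rewrite big_ord_recl expn0 divn1 muln1.
under eq_bigr => i _ do
  rewrite /= expnS divnMA mulnCA divn2.
rewrite -big_distrr /= IHQ; last first.
  by rewrite ltn_half_double -mul2n -expnS.
by rewrite mul2n odd_double_half.
Qed.

Lemma digits_inj (Q : nat) : injective (@digits Q).
Proof.
by move=> i j eq_ij; apply: val_inj; rewrite /= -digitsK eq_ij digitsK.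
Qed.

Lemma digits_bij (Q : nat) : bijective (@digits Q).
Proof.
by apply: inj_card_bij; [exact: digits_inj|rewrite card_tuple card_bool card_ord].
Qed.

Section Qubits.
Variable R : realType.

Definition ket (Q : nat) (j : 'I_(2 ^ Q)) : 'cV[R[i]]_(2 ^ Q) := delta_mx j 0.

Definition translation_mx (Q : nat) : 'M[R[i]]_(2 ^ Q) :=
  \matrix_(i, j) (digits i == rot_tuple 1 (digits j))%:R.

Definition translation (Q : nat) : 'End('cV[R[i]]_(2 ^ Q)) :=
  linfun (mulmx (translation_mx Q)).

Lemma translation_ket (Q : nat) (i j : 'I_(2 ^ Q)) :
  digits i = rot_tuple 1 (digits j) -> translation Q (ket j) = ket i.
Proof.
move=> ij; rewrite lfunE /= /ket -colE; apply/matrixP => k l.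
rewrite !mxE ord1 eqxx andbT -ij.
by rewrite (inj_eq (@digits_inj Q)).
Qed.

Definition Eig (Q : nat) (w : R[i]) : {vspace 'cV[R[i]]_(2 ^ Q)} :=
  passmx.leigenspace (translation Q) w.

Definition inner (n : nat) (u v : 'cV[R[i]]_n) : R[i] :=
  \sum_(j < n) (u j 0)^* * v j 0.

Definition physical_sector (Q : nat) (w : R[i]) : set 'cV[R[i]]_(2 ^ Q) :=
  [set psi | psi \in Eig Q w /\ inner psi psi = 1].

(* The identification of C^n with the real space R^(2n), by which subsets of  *)
(* C^n are regarded as subsets of a real vector space.                        *)
Definition realify (n : nat) (u : 'cV[R[i]]_n) : 'rV[R]_(n + n) :=
  row_mx (\row_j complex.Re (u j 0)) (\row_j complex.Im (u j 0)).

End Qubits.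

Arguments physical_sector : clear implicits.

Section Manifolds.
Variable R : realType.

(* For open U this is C^oo: all iterated directional derivatives              *)
(* 'D_v1 ('D_v2 (.. f)) are (Frechet) differentiable on U.                    *)
Definition smooth_on (V W : normedModType R) (U : set V) (f : V -> W) : Prop :=
  forall (vs : seq V) (x : V), U x ->
    differentiable (foldr (fun v g => 'D_v g) f vs) x.

(* M is a smooth m-dimensional manifold, as a subset of R^n: every point of M *)
(* has an open neighbourhood V such that M `&` V is diffeomorphic to an open  *)
(* U in R^m, where a map on M `&` V is smooth if it extends smoothly to V.    *)
Definition smooth_manifold (n m : nat) (M : set 'rV[R]_n) : Prop :=
  forall p, M p ->
  exists (V : set 'rV[R]_n) (U : set 'rV[R]_m)
         (phi : 'rV[R]_n -> 'rV[R]_m) (psi : 'rV[R]_m -> 'rV[R]_n),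
  [/\ [/\ open V, V p & open U],
      smooth_on V phi, smooth_on U psi,
      forall x, M x -> V x -> U (phi x) /\ psi (phi x) = x
    & forall u, U u -> [/\ M (psi u), V (psi u) & phi (psi u) = u]].

(* The empty set, a manifold of every dimension, is excluded. *)
Definition manifold_dim (n : nat) (M : set 'rV[R]_n) (m : nat) : Prop :=
  M !=set0 /\ smooth_manifold m M.

End Manifolds.

(* The recursion for #(k) is run with fuel n; sharpE gives the recursion      *)
(* itself. The value at k = 0 is irrelevant.                                  *)
Fixpoint sharp_rec (n k : nat) : int :=
  if n is n'.+1 then
    2 ^+ k - \sum_(1 <= k' < k | (k' %| k)%N) sharp_rec n' k'
  else 0.

Definition sharp (k : nat) : int := sharp_rec k k.

Lemma sharp1 : sharp 1 = 2.
Proof. by rewrite /sharp /= big_geq // subr0. Qed.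

Lemma sharpE (k : nat) : (0 < k)%N ->
  sharp k = 2 ^+ k - \sum_(1 <= k' < k | (k' %| k)%N) sharp k'.
Proof.
have fuel n m k' : (0 < k')%N -> (k' <= n)%N -> (k' <= m)%N ->
    sharp_rec n k' = sharp_rec m k'.
  elim: n m k' => [|n IHn] [|m] k' k'0; rewrite ?leqn0.
  - by [].
  - by move=> /eqP k'e; rewrite k'e in k'0.
  - by move=> _ /eqP k'e; rewrite k'e in k'0.
  move=> k'n k'm /=; congr (_ - _).
  rewrite big_nat_cond [RHS]big_nat_cond.
  apply: eq_bigr => i /andP[/andP[i0 ik] _].
  by apply: IHn => //; rewrite -ltnS; apply: leq_trans ik _.
case: k => // k _; rewrite [LHS]/sharp [LHS]/=; congr (_ - _).
rewrite big_nat_cond [RHS]big_nat_cond.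
by apply: eq_bigr => i /andP[/andP[i0 ik] _]; apply: fuel.
Qed.

(* [#](k), a priori only a rational number. *)
Definition sharp_quot (k : nat) : rat := (sharp k)%:~R / k%:R.

(* Main.v *)
Require Import Defs.
From mathcomp Require Import all_boot all_order all_algebra.
From mathcomp Require Import complex ring lra.
From mathcomp Require Import all_classical all_reals topology normedtype derive.
From mathcomp Require Import landau.

(* If w^Q = 1, then Q^-1 * sum_(j < Q) w^-j tau^j is a projection onto Eig(w),
   so its trace is dim Eig(w). The trace of tau^j is the number of bit strings
   fixed by the j-fold shift, that is 2^gcd(j, Q), the sum of #(k) over the
   common divisors k of j and Q. After exchanging the sums, the coefficient of
   #(k) is a sum of the w^-j over the multiples j < Q of k, which is Q/k when
   d | k and 0 otherwise. All #(k) are positive, whence (1). If w^Q <> 1, both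
   sides of (2) vanish because tau^Q = 1.

   For (3), the sector becomes the Euclidean unit sphere of a real subspace of
   dimension 2 dim Eig(w), and stereographic projection from -p is a chart
   around p. Such charts are rational, and rational functions without poles on
   an open set are closed under directional derivatives there. *)

Set Implicit Arguments.
Unset Strict Implicit.
Unset Printing Implicit Defensive.

Import Order.TTheory GRing.Theory Num.Theory.
Import numFieldNormedType.Exports.

Local Open Scope ring_scope.
Local Open Scope classical_set_scope.

(** * Smoothness of rational maps *)

(** The first-order expansion of [f] at [x] involves only values near [x], so it is also one of [g],
    and [diff_unique] identifies the two differentials. *)
Lemma near_eq_differentiable (R : numFieldType) (V W : normedModType R)
    (f g : V -> W) (x : V) :
  (\near x, f x = g x) -> differentiable f x -> differentiable g x.
Proof.
move=> fg fx; have [dfc dfE] := (diff_locallyP x f).1 fx.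
have gE : g \o shift x = cst (g x) + 'd f x +o_ 0 id.
  apply/eqaddoP => e e0; have /eqaddoP/(_ e e0) fe := dfE.
  rewrite -(nbhs_singleton fg).
  have fg0 : \forall h \near 0, f (h + x) = g (h + x).
    by move: fg; rewrite (near_shift 0 x) /= subr0; apply: filterS => h /=.
  near=> h; rewrite /= !fctE /=.
  by rewrite -(near fg0 h) //; near: h.
apply/diff_locallyP; rewrite (diff_unique dfc gE); split => //.
Unshelve. all: by end_near. Qed.

Section Rational.
Variables (R : realType) (m : nat) (U : set 'rV[R]_m).

(** An inductive class instead of quotients of polynomials, so that differentiability and closure
    under derivatives follow by structural induction. *)
Inductive rational_on : ('rV[R]_m -> R) -> Prop :=
| rational_cst c : rational_on (fun=> c)
| rational_coord i : rational_on (fun x => x 0 i)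
| rationalD f g : rational_on f -> rational_on g ->
    rational_on (fun x => f x + g x)
| rationalM f g : rational_on f -> rational_on g ->
    rational_on (fun x => f x * g x)
| rationalV f : rational_on f -> (forall x, U x -> f x != 0) ->
    rational_on (fun x => (f x)^-1).

Lemma rational_sum (I : Type) (r : seq I) (P : pred I)
    (f : I -> 'rV[R]_m -> R) :
  (forall i, P i -> rational_on (f i)) ->
  rational_on (fun x => \sum_(i <- r | P i) f i x).
Proof.
move=> fr; elim: r => [|i r IH].
  by under eq_fun do rewrite big_nil; exact: rational_cst.
case: (boolP (P i)) => Pi.
  under eq_fun do rewrite big_cons Pi; exact: rationalD (fr i Pi) IH.
by under eq_fun do rewrite big_cons (negbTE Pi).
Qed.

Lemma rational_differentiable f : rational_on f ->
  forall x, U x -> differentiable f x.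
Proof.
elim=> {f} [c|i|f g _ fd _ gd|f g _ fd _ gd|f _ fd f0] x Ux.
- exact: differentiable_cst.
- exact: differentiable_coord.
- exact: differentiableD (fd _ Ux) (gd _ Ux).
- exact: differentiableM (fd _ Ux) (gd _ Ux).
- exact: differentiableV (fd _ Ux) (f0 _ Ux).
Qed.

Lemma rational_derive f v : rational_on f ->
  exists g, rational_on g /\ forall x, U x -> 'D_v f x = g x.
Proof.
have der h x : rational_on h -> U x -> derivable h x v.
  by move=> hr Ux; exact/diff_derivable/rational_differentiable.
elim=> {f} [c|i|f g fr [f' [fr' fE]] gr [g' [gr' gE]]
           |f g fr [f' [fr' fE]] gr [g' [gr' gE]]
           |f fr [f' [fr' fE]] f0].
- by exists (fun=> 0); split=> [|x _]; [exact: rational_cst|exact: derive_cst].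
- exists (fun=> v 0 i); split=> [|x _]; first exact: rational_cst.
  (* The derivative of a coordinate is read off entrywise from that of the identity. *)
  have /matrixP/(_ 0 i) := derive_mx (M := id) (derivable_id (x := x) (v := v)).
  by rewrite mxE derive_id => ->.
- exists (fun x => f' x + g' x); split=> [|x Ux]; first exact: rationalD.
  by rewrite -fE // -gE //; apply: deriveD; exact: der.
- exists (fun x => f x * g' x + g x * f' x); split=> [|x Ux].
    by apply: rationalD; exact: rationalM.
  by rewrite -fE // -gE //; apply: deriveM; exact: der.
- exists (fun x => (-1) * ((f x)^-1 * (f x)^-1) * f' x); split=> [|x Ux].
    apply: rationalM => //; apply: rationalM; first exact: rational_cst.
    by apply: rationalM; exact: rationalV.
  rewrite -fE // deriveV ?f0 //; last exact: der.
  by rewrite mulN1r -expr2 exprVn.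
Qed.

(* Derivatives of f agree with rational maps on U only, hence the detour
   through an arbitrary g in the induction. *)
Lemma rational_smooth_on n (f : 'rV[R]_m -> 'rV[R]_n) : open U ->
  (forall j, rational_on (fun x => f x 0 j)) -> smooth_on U f.
Proof.
move=> oU fr vs.
have diff (g : 'rV[R]_m -> 'rV[R]_n) :
    (forall j, rational_on (fun x => g x 0 j)) ->
    forall x, U x -> differentiable g x.
  move=> gr x Ux.
  have -> : g = \sum_(j < n) (fun y => g y 0 j *: delta_mx 0 j).
    apply/funext => y; by rewrite fct_sumE {1}[g y]row_sum_delta.
  apply: differentiable_sum => j; apply: differentiableZl.
  exact: rational_differentiable.
have [g gr gE] : exists2 g : 'rV[R]_m -> 'rV[R]_n,
    (forall j, rational_on (fun x => g x 0 j)) &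
    forall x, U x -> foldr (fun v h => 'D_v h) f vs x = g x.
  elim: vs => [|v vs [g gr gE]]; first by exists f.
  have [g' g'P] := choice (fun j => rational_derive v (gr j)).
  pose G x : 'rV[R]_n := \row_j g' j x; exists G => [j|x Ux].
    have -> : (fun x => G x 0 j) = g' j by apply/funext => x; rewrite mxE.
    by have [] := g'P j.
  rewrite /=; rewrite (@near_eq_derive _ _ _ _ g); last first.
    by apply: filterS (open_nbhs_nbhs (conj oU Ux)) => y /gE.
  rewrite derive_mx; last exact/diff_derivable/diff.
  by apply/rowP => j; rewrite !mxE; have [_ ->] := g'P j.
move=> x Ux; apply: near_eq_differentiable (diff g gr x Ux).
by apply: filterS (open_nbhs_nbhs (conj oU Ux)) => y /gE.
Qed.

End Rational.

(** * The unit sphere of a real subspace *)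

Definition dot (R : realType) (n : nat) (x y : 'rV[R]_n) : R := (x *m y^T) 0 0.

Section Sphere.
Variables (R : realType) (n : nat).
Implicit Types x y : 'rV[R]_n.

Lemma dotE x y : dot x y = \sum_j x 0 j * y 0 j.
Proof. by rewrite /dot mxE; apply: eq_bigr => j _; rewrite mxE. Qed.

Lemma dotC x y : dot x y = dot y x.
Proof. by rewrite !dotE; apply: eq_bigr => j _; rewrite mulrC. Qed.

Lemma dotDl x y z : dot (x + y) z = dot x z + dot y z.
Proof. by rewrite /dot mulmxDl mxE. Qed.

Lemma dotZl a x y : dot (a *: x) y = a * dot x y.
Proof. by rewrite /dot -scalemxAl mxE. Qed.

Lemma dotDr x y z : dot z (x + y) = dot z x + dot z y.
Proof. by rewrite dotC dotDl !(dotC z). Qed.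

Lemma dotZr a x y : dot x (a *: y) = a * dot x y.
Proof. by rewrite dotC dotZl dotC. Qed.

Lemma dot_ge0 x : 0 <= dot x x.
Proof. by rewrite dotE; apply: sumr_ge0 => j _; rewrite -expr2 sqr_ge0. Qed.

Lemma dot_eq0 x : (dot x x == 0) = (x == 0).
Proof.
apply/idP/eqP => [|->]; last by rewrite /dot mul0mx mxE.
rewrite dotE psumr_eq0 => [/allP x0|j _]; last by rewrite -expr2 sqr_ge0.
apply/rowP => j; have := x0 j (mem_index_enum j).
by rewrite -expr2 sqrf_eq0 mxE => /eqP.
Qed.

Lemma mul_tr_dot x y : x *m y^T = (dot x y)%:M.
Proof. by rewrite [LHS]mx11_scalar. Qed.

Lemma rational_mul_row m (U : set 'rV[R]_m) k (f : 'rV[R]_m -> 'rV[R]_k)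
    (C : 'M[R]_(k, n)) j :
  (forall i, rational_on U (fun u => f u 0 i)) ->
  rational_on U (fun u => (f u *m C) 0 j).
Proof.
move=> fr; under eq_fun do rewrite mxE.
by apply: rational_sum => i _; apply: rationalM => //; exact: rational_cst.
Qed.

Lemma rational_dot m (U : set 'rV[R]_m) (f g : 'rV[R]_m -> 'rV[R]_n) :
  (forall i, rational_on U (fun u => f u 0 i)) ->
  (forall i, rational_on U (fun u => g u 0 i)) ->
  rational_on U (fun u => dot (f u) (g u)).
Proof.
move=> fr gr; under eq_fun do rewrite dotE.
by apply: rational_sum => i _; exact: rationalM.
Qed.

Lemma open_dot_neq (q : 'rV[R]_n) (c : R) : open [set x | dot x q != c].
Proof.
apply: (@open_comp _ _ (fun x => dot x q) [set y | y != c]) => [x _|].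
  apply: (@differentiable_continuous _ _ _ x (fun x => dot x q)).
  apply: (rational_differentiable (U := setT)) => //.
  by apply: rational_dot => i; [exact: rational_coord|exact: rational_cst].
exact: open_neq.
Qed.

End Sphere.

Lemma unit_sphere_manifold (R : realType) (k n : nat) (A : 'M[R]_(k, n)) :
  row_free A ->
  smooth_manifold k.-1 [set x : 'rV[R]_n | (x <= A)%MS /\ dot x x = 1].
Proof.
move=> Afree p [pA pp].
(* [T] is the tangent space at [p]: the vectors of the subspace orthogonal to [p]. *)
pose T := (A :&: kermx p^T)%MS.
have Tdot x : (x <= T)%MS = (x <= A)%MS && (dot x p == 0).
  rewrite sub_capmx; congr (_ && _); rewrite sub_kermx mul_tr_dot.
  by apply/eqP/eqP => [/matrixP/(_ 0 0)|->]; rewrite ?raddf0 // !mxE.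
pose B := row_base T.
(* The subspace is the direct sum of [T] and the line through [p], which is nonzero. *)
have rT : \rank T = k.-1.
  have dec x : (x <= A)%MS -> (x - dot x p *: p <= T)%MS.
    move=> xA; rewrite Tdot addmx_sub ?eqmx_opp ?scalemx_sub //=.
    by rewrite -scaleNr dotDl dotZl pp mulr1 subrr.
  have AE : (A :=: T + p)%MS.
    apply/eqmxP; rewrite addsmx_sub pA capmxSl !andbT.
    apply/row_subP => i; rewrite -[row i A](subrK (dot (row i A) p *: p)).
    by rewrite addmx_sub_adds ?scalemx_sub // dec ?row_sub.
  have cap0 : (T :&: p)%MS = 0.
    apply/eqP; rewrite -submx0; apply/rV_subP => x; rewrite sub_capmx Tdot.
    case/andP => /andP[_ xp] /sub_rVP[a xE]; rewrite xE dotZl pp mulr1 in xp.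
    by rewrite xE (eqP xp) scale0r sub0mx.
  have := mxrank_disjoint_sum cap0; rewrite -AE (eqP Afree).
  rewrite rank_rV; case: eqVneq pp => [->|_ _ ->]; last by rewrite addn1.
  by rewrite /dot mul0mx mxE => /eqP; rewrite eq_sym oner_eq0.
rewrite -rT.
(* q is the pole of the stereographic projection. *)
pose q := - p.
have qq : dot q q = 1 by rewrite /q -scaleN1r dotZl dotZr pp; ring.
have qA : (q <= A)%MS by rewrite eqmx_opp.
have Bq (u : 'rV_(\rank T)) : dot (u *m B) q = 0.
  have : (u *m B <= T)%MS by rewrite (submx_trans (submxMl _ _)) ?eq_row_base.
  by rewrite Tdot => /andP[_ /eqP up]; rewrite /q -scaleN1r dotZr up mulr0.
have BA (u : 'rV_(\rank T)) : (u *m B <= A)%MS.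
  have : (u *m B <= T)%MS by rewrite (submx_trans (submxMl _ _)) ?eq_row_base.
  by rewrite Tdot => /andP[].
have [B' BB'] := row_freeP (row_base_free T).
(* Orthogonal projection away from [q], followed by taking coordinates in the basis [B] of [T]. It
   is linear on the whole ambient space, as an extension of the chart must be. *)
pose C := (1%:M - q^T *m q) *m B'.
have xC (x : 'rV_n) : x *m C = (x - dot x q *: q) *m B'.
  by rewrite /C mulmxA mulmxBr mulmx1 (mulmxA x) mul_tr_dot mul_scalar_mx.
have BC (u : 'rV_(\rank T)) : u *m B *m C = u.
  by rewrite xC Bq scale0r subr0 -mulmxA BB' mulmx1.
have qC : q *m C = 0 by rewrite xC qq scale1r subrr mul0mx.
have dec x : (x <= A)%MS -> x = x *m C *m B + dot x q *: q.
  move=> xA; have : (x - dot x q *: q <= T)%MS.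
    rewrite Tdot addmx_sub ?eqmx_opp ?scalemx_sub //=.
    rewrite -[p]opprK -/q -[- q]scaleN1r dotZr.
    by rewrite -scaleNr dotDl dotZl qq mulr1 subrr mulr0.
  rewrite -(eq_row_base T) -/B => /submxP[u uE].
  have -> : x *m C = u.
    rewrite -[x](subrK (dot x q *: q)) uE mulmxDl BC -scalemxAl qC.
    by rewrite scaler0 addr0.
  by rewrite -uE subrK.
(* The rows of [B] need not be orthonormal, so the squared length of the tangent vector is a
   quadratic form in [u]. *)
pose N (u : 'rV_(\rank T)) := dot (u *m B) (u *m B).
have N0 u : 0 < N u + 1 by rewrite ltr_wpDl ?dot_ge0.
(* The line from [q] through [x] meets [T] at parameter [1 / (1 - dot x q)]; [psi] sends a point of
   [T] to the second intersection of its line through [q] with the sphere. *)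
pose phi x := (1 - dot x q)^-1 *: (x *m C).
pose psi u := (N u + 1)^-1 *: (2 *: (u *m B) + (N u - 1) *: q).
exists [set x | dot x q != 1], setT, phi, psi; split.
- split; [exact: open_dot_neq| |exact: openT].
  rewrite /= /q -scaleN1r dotZr pp mulr1 -subr_eq0; apply/eqP; lra.
- apply: rational_smooth_on => [|j]; first exact: open_dot_neq.
  under [X in rational_on _ X]eq_fun do rewrite mxE.
  apply: rationalM; last first.
    by apply: rational_mul_row => i; exact: rational_coord.
  apply: rationalV => [|x /=]; last by rewrite subr_eq0 eq_sym.
  under [X in rational_on _ X]eq_fun do rewrite -mulN1r.
  apply: rationalD; first exact: rational_cst.
  apply: rationalM; first exact: rational_cst.
  by apply: rational_dot => i; [exact: rational_coord|exact: rational_cst].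
- have BR j : rational_on setT (fun u : 'rV_(\rank T) => (u *m B) 0 j).
    by apply: rational_mul_row => i; exact: rational_coord.
  have NR : rational_on setT N by exact: rational_dot.
  apply: rational_smooth_on => [|j]; first exact: openT.
  have -> : (fun u => psi u 0 j) = fun u =>
      (N u + 1)^-1 * (2 * (u *m B) 0 j + (N u - 1) * q 0 j).
    by apply/funext => u; rewrite /psi !mxE.
  apply: rationalM.
    apply: rationalV => [|u _]; last by rewrite gt_eqF.
    by apply: rationalD => //; exact: rational_cst.
  apply: rationalD.
    by apply: rationalM => //; exact: rational_cst.
  apply: rationalM; last exact: rational_cst.
  by apply: rationalD => //; exact: rational_cst.
- move=> x [xA xx] /= xq; split=> //; have := dec x xA.
  set u := x *m C; set c := dot x q in xq *; move=> xE.
  have c1 : 1 - c != 0 by rewrite subr_eq0 eq_sym.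
  (* Pythagoras for the unit vector [x], split into its parts along [T] and [q]. *)
  have uu : N u = 1 - c ^+ 2.
    rewrite -xx xE dotDl !dotDr !dotZl !dotZr Bq (dotC q) Bq qq /N; ring.
  have NE : N (phi x) = (1 + c) / (1 - c).
    rewrite /N /phi -/u -/c -scalemxAl dotZl dotZr -/(N u) uu.
    by field.
  have cD : (1 + c) / (1 - c) + 1 = 2 / (1 - c) by field.
  have cB : (1 + c) / (1 - c) - 1 = 2 * c / (1 - c) by field.
  rewrite /psi NE cD cB /phi -/u -/c [RHS]xE -[in RHS](scale1r (u *m B)).
  rewrite -scalemxAl !scalerDr !scalerA.
  by congr (_ *: _ + _ *: _); field; rewrite ?c1 ?pnatr_eq0.
- move=> u _.
  have Nu : N u + 1 != 0 by rewrite gt_eqF.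
  have pq : dot (psi u) q = (N u - 1) / (N u + 1).
    rewrite /psi dotZl dotDl !dotZl Bq qq; by field.
  split=> /=.
  + split.
      by rewrite scalemx_sub // addmx_sub // scalemx_sub.
    rewrite /psi dotZl dotZr dotDl !dotDr !dotZl !dotZr Bq (dotC q) Bq qq.
    by rewrite -/(N u); field.
  + rewrite pq -subr_eq0 (_ : _ - 1 = -2 / (N u + 1)); last by field.
    by rewrite mulf_neq0 ?invr_neq0 ?oppr_eq0 ?pnatr_eq0.
  + rewrite /phi pq /psi -scalemxAl mulmxDl -!scalemxAl BC qC scaler0 addr0.
    rewrite (_ : 1 - _ = 2 / (N u + 1)); last by field.
    rewrite !scalerA -[RHS]scale1r; congr (_ *: _).
    by field; rewrite ?pnatr_eq0.
Qed.

Lemma unit_sphere_nonempty (R : realType) (k n : nat) (A : 'M[R]_(k, n)) :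
  (0 < k)%N -> row_free A ->
  [set x : 'rV[R]_n | (x <= A)%MS /\ dot x x = 1] !=set0.
Proof.
move=> k0 Afree.
pose x := row (Ordinal k0) A.
have x0 : 0 < dot x x.
  rewrite lt_def dot_ge0 andbT dot_eq0; apply/negP => /eqP x0.
  have xE : delta_mx 0 (Ordinal k0) *m A = 0 *m A :> 'rV_n.
    by rewrite -rowE mul0mx.
  have /rowP/(_ (Ordinal k0)) := row_free_inj Afree xE.
  by rewrite !mxE !eqxx => /eqP; rewrite oner_eq0.
exists ((Num.sqrt (dot x x))^-1 *: x); split.
  by rewrite scalemx_sub ?row_sub.
rewrite dotZl dotZr mulrA -expr2 exprVn sqr_sqrtr ?ltW // mulVf //.
by rewrite gt_eqF.
Qed.

(** * Counting shift-invariant bit strings *)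

Lemma sum_divisors_sharp (n : nat) : (0 < n)%N ->
  \sum_(1 <= k < n.+1 | (k %| n)%N) sharp k = 2 ^+ n.
Proof.
move=> n0; rewrite big_mkcond big_nat_recr //= -big_mkcond dvdnn.
by rewrite [X in _ + X]sharpE // addrC subrK.
Qed.

(** Each bound at [k] uses the other one below [k]: the subtracted sum is nonnegative by positivity,
    and by the upper bounds it is at most 2 + 4 + ... + 2^(k-1) = 2^k - 2. *)
Lemma sharp_bounds (k : nat) : (0 < k)%N -> 0 < sharp k <= 2 ^+ k.
Proof.
elim/ltn_ind: k => k IH k0; rewrite sharpE //.
have geom n : (0 < n)%N -> \sum_(1 <= i < n) 2 ^+ i = 2 ^+ n - 2 :> int.
  elim: n => // -[_ _|n IHn _]; first by rewrite big_geq.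
  by rewrite big_nat_recr //= IHn // [2 ^+ n.+2]exprS; ring.
apply/andP; split; last first.
  rewrite gerBl big_nat_cond; apply: sumr_ge0 => i /andP[/andP[i0 ik] _].
  by have /andP[/ltW] := IH i ik i0.
rewrite subr_gt0 (@le_lt_trans _ _ (2 ^+ k - 2)) ?gtrBl // -geom //.
rewrite big_mkcond big_nat_cond [leRHS]big_nat_cond; apply: ler_sum => i.
rewrite andbT => /andP[i0 ik]; case: ifP => _; last exact: exprn_ge0.
by have /andP[] := IH i ik i0.
Qed.

Lemma sharp_quot_gt0 (k : nat) : (0 < k)%N -> 0 < sharp_quot k.
Proof.
move=> k0; have /andP[s0 _] := sharp_bounds k0.
by rewrite divr_gt0 ?ltr0n ?ltr0z.
Qed.

Lemma big_nat_multiples (V : nmodType) (m k : nat) (f : nat -> V) : (0 < k)%N ->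
  \sum_(0 <= j < m * k | (k %| j)%N) f j = \sum_(0 <= i < m) f (i * k)%N.
Proof.
move=> k0; elim: m => [|m IH]; first by rewrite mul0n !big_geq.
rewrite (@big_cat_nat _ _ _ (m * k)) ?leq_mul2r ?leqnSn ?orbT //= IH.
rewrite big_nat_recr //=; congr (_ + _).
(* In the block from [m * k] up to [m.+1 * k], only the first index is a multiple of [k]. *)
rewrite big_ltn_cond ?ltn_mul2r ?k0 //= dvdn_mull // big_nat_cond.
rewrite big_pred0 ?addr0 //.
move=> j; apply/negP => /andP[/andP[mj jm] /dvdnP[i jE]].
move: mj jm; rewrite jE !ltn_mul2r k0 /= ltnS => /leq_trans h /h.
by rewrite ltnn.
Qed.

(** With [j = k * i] this is a geometric sum of [Q %/ k] powers of [z ^+ k]. Either [z ^+ k = 1], or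
    multiplying by [z ^+ k - 1] gives [z ^+ Q - 1 = 0]. *)
Lemma sum_multiples_root (F : fieldType) (z : F) (d Q k : nat) :
  d.-primitive_root z -> (d %| Q)%N -> (k %| Q)%N -> (0 < k)%N ->
  \sum_(0 <= j < Q | (k %| j)%N) z ^+ j =
    if (d %| k)%N then (Q %/ k)%:R else 0.
Proof.
move=> zd dQ kQ k0; rewrite -{1}(divnK kQ) big_nat_multiples //.
under eq_bigr do rewrite mulnC exprM.
rewrite big_mkord; case: ifPn => dk.
  have -> : z ^+ k = 1 by apply/eqP; rewrite -(prim_order_dvd zd).
  by under eq_bigr do rewrite expr1n; rewrite sumr_const card_ord.
have zk : z ^+ k - 1 != 0 by rewrite subr_eq0 -(prim_order_dvd zd).
apply: (mulfI zk); rewrite mulr0 -subrX1 -exprM mulnC divnK //.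
by apply/eqP; rewrite subr_eq0 -(prim_order_dvd zd).
Qed.

Lemma sum_root_pow2_gcd (F : numFieldType) (z : F) (d Q : nat) :
  d.-primitive_root z -> (d %| Q)%N -> (0 < Q)%N ->
  Q%:R^-1 * \sum_(j < Q) z ^+ j * (2 ^ gcdn j Q)%:R =
    ratr (\sum_(1 <= k < Q.+1 | (d %| k)%N && (k %| Q)%N) sharp_quot k).
Proof.
move=> zd dQ Q0.
(* The range of [k] is enlarged to all divisors of [Q], independently of [j], so that the sums over
   [j] and [k] can be exchanged. *)
have powE j : (2 ^ gcdn j Q)%:R =
    \sum_(1 <= k < Q.+1 | (k %| Q)%N)
      (if (k %| j)%N then (sharp k)%:~R else 0 : F).
  have g0 : (0 < gcdn j Q)%N by rewrite gcdn_gt0 Q0 orbT.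
  have -> : (2 ^ gcdn j Q)%:R = (2 ^+ gcdn j Q : int)%:~R :> F.
    by rewrite natrX rmorphXn.
  rewrite -sum_divisors_sharp // rmorph_sum /= -big_mkcondr.
  rewrite [RHS](@big_cat_nat _ _ _ (gcdn j Q).+1) //=; last first.
    by rewrite ltnS dvdn_leq ?dvdn_gcdr.
  rewrite [X in _ = _ + X]big_nat_cond [X in _ = _ + X]big_pred0 => [|k].
    by rewrite addr0; apply: eq_bigl => k; rewrite dvdn_gcd andbC.
  apply/negP => /andP[/andP[gk _] /andP[kQ kj]].
  have : (k %| gcdn j Q)%N by rewrite dvdn_gcd kj.
  by move/(dvdn_leq g0); rewrite leqNgt gk.
under eq_bigr do rewrite powE mulr_sumr.
rewrite exchange_big /= mulr_sumr rmorph_sum /= big_mkcondl /=.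
rewrite big_nat_cond [RHS]big_nat_cond; apply: eq_bigr => k.
case/andP => /andP[k0 _] kQ.
have -> : \sum_(j < Q) z ^+ j * (if (k %| j)%N then (sharp k)%:~R else 0) =
    (sharp k)%:~R * \sum_(0 <= j < Q | (k %| j)%N) z ^+ j.
  rewrite big_mkord mulr_sumr [RHS]big_mkcond /=; apply: eq_bigr => j _.
  by case: ifP; rewrite ?mulr0 // mulrC.
rewrite (sum_multiples_root zd) //; case: ifP => _; last by rewrite !mulr0.
rewrite /sharp_quot fmorph_div rmorph_int rmorph_nat natf_div //.
have Q0' : Q%:R != 0 :> F by rewrite pnatr_eq0 -lt0n.
have k0' : k%:R != 0 :> F by rewrite pnatr_eq0 -lt0n.
by field; rewrite Q0' k0'.
Qed.

Definition cyclic_shift (Q : nat) (t : Q.-tuple bool) : Q.-tuple bool :=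
  rot_tuple 1 t.

Arguments cyclic_shift {Q} t.

Section CyclicShift.
Variable Q : nat.
Implicit Types t : Q.-tuple bool.

Local Notation shift := (@cyclic_shift Q).

Lemma nth_iter_shift j t i : (i < Q)%N ->
  nth false (iter j shift t) i = nth false t ((i + j) %% Q).
Proof.
move=> iQ; elim: j i iQ => [|j IH] i iQ; first by rewrite addn0 modn_small.
have rot1E (s : seq bool) : size s = Q ->
    nth false (rot 1 s) i = nth false s (i.+1 %% Q).
  case: s => [|x s] /= sz; rewrite -sz in iQ *; first by [].
  rewrite rot1_cons nth_rcons; move: iQ; rewrite ltnS leq_eqVlt.
  case/orP=> [/eqP->|lt_is]; first by rewrite ltnn eqxx modnn.
  by rewrite lt_is modn_small.
rewrite iterS /= rot1E ?size_tuple // IH ?ltn_mod; last exact: leq_ltn_trans iQ.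
by rewrite modnDml addSnnS.
Qed.

Lemma iter_shift_mul m t : iter (m * Q) shift t = t.
Proof.
apply: eq_from_tnth => i; rewrite !(tnth_nth false) nth_iter_shift //.
by rewrite addnC modnMDl modn_small.
Qed.

(** By Bezout, [gcdn j Q + a * j] is a multiple of [Q] for some [a]. Shifting by that multiple fixes
    [t], and so does shifting by [a * j]. *)
Lemma iter_shift_gcd j t : (0 < Q)%N ->
  iter j shift t = t -> iter (gcdn j Q) shift t = t.
Proof.
move=> Q0 jt; have [a _ /dvdnP[m aE]] := Bezoutl j Q0.
have mt : iter (a * j) shift t = t.
  by elim: a {aE} => // a IHa; rewrite mulSn iterD IHa.
by rewrite -{1}mt -iterD gcdnC aE iter_shift_mul.
Qed.

(** The fixed strings are those with period [g = gcdn j Q]; they correspond to their first [g]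
    digits, which [e] repeats periodically. *)
Lemma card_iter_shift_fixed j : (0 < Q)%N ->
  #|[set t | iter j shift t == t]%SET| = (2 ^ gcdn j Q)%N.
Proof.
move=> Q0; set g := gcdn j Q.
have g0 : (0 < g)%N by rewrite gcdn_gt0 Q0 orbT.
have gQ : (g %| Q)%N by rewrite dvdn_gcdr.
pose e (s : g.-tuple bool) : Q.-tuple bool :=
  [tuple nth false s (i %% g) | i < Q].
have eE s i : (i < Q)%N -> nth false (e s) i = nth false s (i %% g).
  by move=> iQ; rewrite -(tnth_nth false (e s) (Ordinal iQ)) tnth_mktuple.
have e_inj : injective e.
  move=> s s' ss'; apply: eq_from_tnth => i; rewrite !(tnth_nth false).
  have iQ : (i < Q)%N by apply: leq_trans (dvdn_leq Q0 gQ).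
  by have := eE s i iQ; rewrite ss' eE // modn_small.
have -> : [set t | iter j shift t == t]%SET =
    [set e s | s in [set: g.-tuple bool]]%SET.
  apply/setP => t; rewrite inE; apply/eqP/imsetP => [jt|[s _ ->]].
    exists [tuple nth false t i | i < g] => //; apply: eq_from_tnth => i.
    have gt m : iter (m * g) shift t = t.
      by elim: m => // m IHm; rewrite mulSn iterD IHm iter_shift_gcd.
    have ig : (i %% g < g)%N by rewrite ltn_mod.
    rewrite tnth_mktuple -(tnth_nth false _ (Ordinal ig)) tnth_mktuple /=.
    rewrite -{2}(gt (i %/ g)%N) nth_iter_shift; last first.
      by apply: leq_trans (dvdn_leq Q0 gQ).
    by rewrite addnC -divn_eq modn_small // (tnth_nth false).
  apply: eq_from_tnth => i; rewrite !(tnth_nth false) nth_iter_shift //.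
  rewrite !eE ?ltn_mod // modn_dvdm // -modnDmr.
  by rewrite (eqP (dvdn_gcdl j Q : (g %| j)%N)) addn0.
by rewrite card_imset // cardsT card_tuple card_bool.
Qed.

End CyclicShift.

(** * The eigenspaces of the translation operator *)

(** The columns of [B] form a basis of [U], which turns [\dim U] into a matrix size. *)
Lemma vspace_basis_mx (F : fieldType) (n : nat) (U : {vspace 'cV[F]_n}) :
  exists B : 'M[F]_(n, \dim U),
    (forall x, x \in U <-> exists c, x = B *m c) /\
    (forall c : 'cV_(\dim U), B *m c = 0 -> c = 0).
Proof.
pose B : 'M_(n, \dim U) := \matrix_(i, j) (vbasis U)`_j i 0.
have BE c : B *m c = \sum_j c j 0 *: (vbasis U)`_j.
  apply/colP => i; rewrite mxE summxE; apply: eq_bigr => j _.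
  by rewrite !mxE mulrC.
exists B; split=> [x|c]; first split=> [xU|[c ->]].
- exists (\col_j coord (vbasis U) j x); rewrite BE {1}(coord_vbasis xU).
  by apply: eq_bigr => j _; rewrite mxE.
- rewrite BE; apply: rpred_sum => j _; apply: rpredZ.
  by apply: vbasis_mem; rewrite mem_nth // size_tuple.
- have /freeP fr := basis_free (vbasisP U).
  rewrite BE => c0; apply/colP => j; rewrite mxE; exact: (fr (fun j => c j 0)).
Qed.

Lemma expr_mulmx_eigenvector (F : fieldType) (n : nat) (T : 'M[F]_n) (w : F)
    (x : 'cV[F]_n) (j : nat) :
  T *m x = w *: x -> T ^+ j *m x = w ^+ j *: x.
Proof.
move=> Tx; elim: j => [|j IH]; first by rewrite mul1mx scale1r.
by rewrite !exprS -mulmxA IH -scalemxAr Tx scalerA mulrC.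
Qed.

(** The averaging operator [P] has image in [U] and fixes [U] pointwise. Hence [P = B *m C] for a
    basis matrix [B], and [P *m B = B] forces [C *m B = 1], so [\tr P = \tr (C *m B) = \dim U]. *)
Lemma dim_eigenspace_trace (F : fieldType) (n Q : nat) (T : 'M[F]_n) (w : F)
    (U : {vspace 'cV[F]_n}) :
  (forall x, (x \in U) = (T *m x == w *: x)) ->
  T ^+ Q = 1 -> w ^+ Q = 1 -> Q%:R != 0 :> F ->
  (\dim U)%:R = Q%:R^-1 * \sum_(j < Q) w^-1 ^+ j * \tr (T ^+ j).
Proof.
move=> UE TQ wQ Q0; have w0 : w != 0.
  apply: contraNneq Q0 => w0; move: wQ; rewrite w0 expr0n.
  by case: eqVneq => [->|_ /eqP]; rewrite // eq_sym oner_eq0.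
pose f j := w^-1 ^+ j *: T ^+ j.
pose P := Q%:R^-1 *: \sum_(j < Q) f j.
have TP : T *m P = w *: P.
  rewrite /P -scalemxAr scalerA mulrC -scalerA; congr (_ *: _).
  have fS j : T *m f j = w *: f j.+1.
    by rewrite /f -scalemxAr scalerA exprS mulrA mulfV // mul1r exprS.
  rewrite mulmx_sumr; under eq_bigr do rewrite fS.
  rewrite -scaler_sumr; congr (_ *: _).
  (* [T] moves each summand to [w] times the next; the sum closes up cyclically because
     [f Q = f 0]. *)
  apply: (addrI (f 0%N)); rewrite -(big_ord_recl Q f) big_ord_recr /= addrC.
  by congr (_ + _); rewrite /f TQ exprVn wQ invr1 expr0.
have PU x : x \in U -> P *m x = x.
  rewrite UE => /eqP Tx.
  have fx j : f j *m x = x.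
    by rewrite /f -scalemxAl (expr_mulmx_eigenvector j Tx) scalerA exprVn
      mulVf ?scale1r // expf_neq0.
  rewrite /P -scalemxAl mulmx_suml; under eq_bigr do rewrite fx.
  by rewrite sumr_const card_ord -scaler_nat scalerA mulVf // scale1r.
have [B [BU B0]] := vspace_basis_mx U.
have /choice[c cE] : forall j, exists c : 'cV_(\dim U), col j P = B *m c.
  move=> j; apply/BU; rewrite UE colE mulmxA TP.
  by rewrite -scalemxAl.
pose C : 'M_(\dim U, n) := \matrix_(i, j) c j i 0.
have PE : P = B *m C.
  apply/matrixP => i j; have /colP/(_ i) := cE j; rewrite !mxE => ->.
  by apply: eq_bigr => k _; rewrite mxE.
have CB : C *m B = 1%:M.
  apply/eqP; rewrite -subr_eq0; apply/eqP/matrixP => i j.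
  have /colP/(_ i) : col j (C *m B - 1%:M) = 0.
    apply: B0; rewrite colE mulmxA mulmxBr mulmxA -PE mulmx1.
    by rewrite mulmxBl -mulmxA PU ?subrr //; apply/BU; exists (delta_mx j 0).
  by rewrite [X in X = _]mxE => ->; rewrite !mxE.
rewrite -(mxtrace1 F) -CB mxtrace_mulC -PE /P mxtraceZ raddf_sum /=.
by congr (_ * _); apply: eq_bigr => j _; rewrite mxtraceZ.
Qed.

Section Translation.
Variables (R : realType) (Q : nat).

Lemma mem_Eig w (x : 'cV[R[i]]_(2 ^ Q)) :
  (x \in Eig Q w) = (translation_mx R Q *m x == w *: x).
Proof.
by rewrite memv_ker add_lfunE opp_lfunE scale_lfunE id_lfunE lfunE /= subr_eq0.
Qed.

Lemma translation_mxX j : translation_mx R Q ^+ j =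
  \matrix_(i, k) (digits i == iter j cyclic_shift (digits k))%:R.
Proof.
elim: j => [|j IH].
  by apply/matrixP => i k; rewrite expr0 !mxE (inj_eq (@digits_inj Q)).
rewrite exprS IH; apply/matrixP => i k; rewrite !mxE /=.
have [g gK Kg] := digits_bij Q.
(* Only the intermediate index whose digits are the [j]-fold shift contributes to this entry. *)
rewrite (bigD1 (g (iter j cyclic_shift (digits k)))) //= !mxE Kg eqxx mulr1.
rewrite big1 ?addr0 // => l lg; rewrite !mxE.
rewrite [digits l == _](_ : _ = false) ?mulr0 //.
by apply: contraNF lg => /eqP <-; rewrite gK.
Qed.

Lemma translation_mx_order : translation_mx R Q ^+ Q = 1.
Proof.
rewrite translation_mxX; apply/matrixP => i k; rewrite !mxE.
by rewrite -[X in iter X]mul1n iter_shift_mul (inj_eq (@digits_inj Q)).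
Qed.

(** The trace of a permutation matrix counts the fixed points of the permutation. *)
Lemma trace_translation_mxX j : (0 < Q)%N ->
  \tr (translation_mx R Q ^+ j) = (2 ^ gcdn j Q)%:R.
Proof.
move=> Q0; rewrite translation_mxX -card_iter_shift_fixed // /mxtrace.
under eq_bigr do rewrite mxE eq_sym.
rewrite -(reindex (@digits Q) (P := xpredT)
  (F := fun t => (iter j cyclic_shift t == t)%:R)) /=; last first.
  exact/onW_bij/digits_bij.
rewrite -natr_sum -sum1dep_card [in RHS]big_mkcond.
by congr _%:R; apply: eq_bigr => t _; case: (_ == _).
Qed.

Lemma dim_Eig d (w : R[i]) : (0 < Q)%N -> d.-primitive_root w ->
  (\dim (Eig Q w))%:R =
    \sum_(1 <= k < Q.+1 | (d %| k)%N && (k %| Q)%N) sharp_quot k.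
Proof.
move=> Q0 wd; have [dQ|ndQ] := boolP (d %| Q)%N; last first.
  rewrite big_pred0 => [|k]; last first.
    by apply/negP => /andP[dk kQ]; rewrite (dvdn_trans dk kQ) in ndQ.
  suff -> : Eig Q w = 0%VS by rewrite dimv0.
  apply/eqP; rewrite -subv0; apply/subvP => x; rewrite mem_Eig memv0 => /eqP Tx.
  (* Here [x = w ^+ Q *: x] with [w ^+ Q != 1], so [x = 0]. *)
  have := expr_mulmx_eigenvector Q Tx.
  rewrite translation_mx_order mul1mx => /esym/eqP.
  rewrite -subr_eq0 -{2}[x]scale1r -scalerBl scaler_eq0 subr_eq0.
  by rewrite -(prim_order_dvd wd) (negbTE ndQ).
(* The trace formula lives in [R[i]], so the rational identity is checked there. *)
apply: (fmorph_inj (ratr : {rmorphism rat -> R[i]})).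
have zd : d.-primitive_root w^-1.
  move: wd; rewrite /primitive_root_of_unity; congr (_ && _).
  by apply: eq_forallb => i; rewrite !unity_rootE exprVn invr_eq1.
rewrite rmorph_nat /= -(sum_root_pow2_gcd zd) //.
rewrite (@dim_eigenspace_trace _ _ Q (translation_mx R Q) w) //.
- by congr (_ * _); apply: eq_bigr => j _; rewrite trace_translation_mxX.
- exact: mem_Eig.
- exact: translation_mx_order.
- by apply/eqP; rewrite -(prim_order_dvd wd).
- by rewrite pnatr_eq0 -lt0n.
Qed.

End Translation.

(** * From complex to real spheres *)

Section Realify.
Variable R : realType.
Local Notation Re := (@complex.Re R).
Local Notation Im := (@complex.Im R).

Lemma Re_sum (I : Type) (r : seq I) (P : pred I) (f : I -> R[i]) :
  Re (\sum_(i <- r | P i) f i) = \sum_(i <- r | P i) Re (f i).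
Proof. by apply: (big_morph Re) => // -[a b] [c d]. Qed.

Lemma Im_sum (I : Type) (r : seq I) (P : pred I) (f : I -> R[i]) :
  Im (\sum_(i <- r | P i) f i) = \sum_(i <- r | P i) Im (f i).
Proof. by apply: (big_morph Im) => // -[a b] [c d]. Qed.

Lemma realify_surj n (y : 'rV[R]_(n + n)) :
  exists u : 'cV[R[i]]_n, realify u = y.
Proof.
exists (\col_j Complex (lsubmx y 0 j) (rsubmx y 0 j)).
rewrite /realify -[RHS]hsubmxK.
by congr row_mx; apply/rowP => j; rewrite !mxE /= ?mxE.
Qed.

Lemma realify_eq0 n (u : 'cV[R[i]]_n) : realify u = 0 -> u = 0.
Proof.
rewrite /realify -row_mx0 => /eq_row_mx[/rowP re0 /rowP im0]; apply/colP => j.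
have := re0 j; have := im0 j; rewrite !mxE.
by case: (u j 0) => a b /= -> ->.
Qed.

Lemma inner_realify n (u : 'cV[R[i]]_n) :
  inner u u = Complex (dot (realify u) (realify u)) 0.
Proof.
have uE j : (u j 0)^* * u j 0 = (Re (u j 0) ^+ 2 + Im (u j 0) ^+ 2)%:C%C.
  by rewrite -normCKC add_Re2_Im2.
rewrite /inner; under eq_bigr do rewrite uE.
rewrite -rmorph_sum; congr (_%:C)%C; rewrite dotE big_split_ord big_split.
by congr (_ + _); apply: eq_bigr => j _; rewrite ?row_mxEl ?row_mxEr mxE -expr2.
Qed.

(** The rows are the realified columns of [B], followed by the realified columns of [i] times
    [B]. *)
Definition realify_mx n m (B : 'M[R[i]]_(n, m)) : 'M[R]_(m + m, n + n) :=
  block_mx (map_mx Re B)^T (map_mx Im B)^T (- map_mx Im B)^T (map_mx Re B)^T.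

Lemma realify_mulmx n m (B : 'M[R[i]]_(n, m)) (c : 'cV_m) :
  realify (B *m c) = realify c *m realify_mx B.
Proof.
rewrite /realify /realify_mx mul_row_block; congr row_mx; apply/rowP => i.
  rewrite !mxE Re_sum -big_split /=; apply: eq_bigr => j _; rewrite !mxE.
  by case: (B i j) (c j 0) => [a b] [a' b'] /=; ring.
rewrite !mxE Im_sum -big_split /=; apply: eq_bigr => j _; rewrite !mxE.
by case: (B i j) (c j 0) => [a b] [a' b'] /=; ring.
Qed.

(** Take [A = realify_mx B] for a basis matrix [B] of [U]: [realify] is bijective, preserves squared
    norms and carries [B] to [A]. Each complex basis vector yields two real ones. *)
Lemma realify_unit_sphere n (U : {vspace 'cV[R[i]]_n}) :
  exists2 A : 'M[R]_(\dim U + \dim U, n + n), row_free A &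
    @realify R n @` [set x | x \in U /\ inner x x = 1] =
    [set y | (y <= A)%MS /\ dot y y = 1].
Proof.
have [B [BU B0]] := vspace_basis_mx U.
exists (realify_mx B).
  apply: inj_row_free => v; have [c <-] := realify_surj v.
  rewrite -realify_mulmx => /realify_eq0/B0 ->.
  by rewrite /realify -row_mx0; congr row_mx; apply/rowP => j; rewrite !mxE.
have unitE (x : 'cV[R[i]]_n) :
    inner x x = 1 <-> dot (realify x) (realify x) = 1.
  by rewrite inner_realify; split=> [[]|->].
apply/seteqP; split=> [_ [x [/BU[c ->] /unitE x1] <-]|y [/submxP[v ->] y1]].
  by split; rewrite // realify_mulmx submxMl.
have [c cE] := realify_surj v; exists (B *m c).
  split; first by apply/BU; exists c.
  by apply/unitE; rewrite realify_mulmx cE.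
by rewrite realify_mulmx cE.
Qed.

End Realify.

Theorem theorem5p1 (R : realType) (Q d : nat) (w : R[i]) (hQ : (1 <= Q)%N)
    (hw : d.-primitive_root w) :
  [/\ (* (1) *)
      ((d %| Q)%N -> passmx.leigenvalue (translation R Q) w),
      (* (2) *)
      (\dim (Eig Q w))%:R
        = \sum_(1 <= k < Q.+1 | (d %| k)%N && (k %| Q)%N) sharp_quot k
    & (* (3) *)
      ((d %| Q)%N ->
       manifold_dim (@realify R (2 ^ Q) @` physical_sector R Q w)
                    (2 * \dim (Eig Q w) - 1)%N)].
Proof.
have dimE := dim_Eig hQ hw.
have dim_gt0 : (d %| Q)%N -> (0 < \dim (Eig Q w))%N.
  (* The term [k = Q] is present since [d] divides [Q], and it is positive; the other terms are
     nonnegative. *)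
  move=> dQ; rewrite -(ltr0n rat) dimE big_mkcond big_nat_recr //= dQ dvdnn.
  rewrite ltr_wpDl ?sharp_quot_gt0 // big_nat_cond; apply: sumr_ge0 => k.
  by case/andP => /andP[k0 _] _; case: ifP => // _; rewrite ltW ?sharp_quot_gt0.
split=> // dQ.
  by rewrite /passmx.leigenvalue -dimv_eq0 -lt0n dim_gt0.
have [A Afree AE] := realify_unit_sphere (Eig Q w).
rewrite /physical_sector AE mul2n -addnn subn1; split.
  by apply: unit_sphere_nonempty => //; rewrite addn_gt0 dim_gt0.
exact: unit_sphere_manifold.
Qed.
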